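(* The set of $\mathcal{P}$-positions of $\mathcal{E}$-Wythoff equals the set of $\mathcal{P}$-positions of Wythoff's game, namely $\{(\lfloor \phi n\rfloor, \lfloor \phi n\rfloor + n) : n \geq 0\}$ (positions being unordered), where $\phi = (1+\sqrt{5})/2$.
   Context: A position is an unordered pair $(a,b)$ of nonnegative integers (pile sizes). Two players alternate; the player making the last move wins. In Wythoff's game a move either removes a positive number of tokens from one pile, or removes the same positive number of tokens from both piles. $\mathcal{E}$-Wythoff is the extension of Wythoff's game obtained by additionally allowing the move that removes $k$ tokens from the smaller pile (or from either pile if the piles are equal) and $l$ tokens from the other pile, for any integers $k \geq 1$, $l \geq 0$ with $l < k$. A $\mathcal{P}$-position is a position from which the player about to move cannot force a win. *)

(* Defs.v *)
From Stdlib Require Import Reals ZArith Arith Lia.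

(** Unordered pairs of pile sizes, stored in sorted order. *)
Record position : Set := Position {
  smaller : nat;
  larger : nat;
  smaller_le_larger : smaller <= larger
}.

Lemma min_le_max (a b : nat) : Nat.min a b <= Nat.max a b.
Proof. lia. Qed.

Definition piles (a b : nat) : position :=
  Position (Nat.min a b) (Nat.max a b) (min_le_max a b).

Lemma position_ext (p q : position) :
  smaller p = smaller q -> larger p = larger q -> p = q.
Proof.
  destruct p as [a b h], q as [c d h']; simpl; intros -> ->.
  now rewrite (Peano_dec.le_unique _ _ h h').
Qed.

Lemma piles_eq_iff (a b c d : nat) :
  piles a b = piles c d <-> (a = c /\ b = d) \/ (a = d /\ b = c).
Proof.
  split.
  - intros e.
    pose proof (f_equal smaller e); pose proof (f_equal larger e).
    simpl in *; lia.
  - intros H; apply position_ext; simpl; lia.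
Qed.

Lemma piles_surj (p : position) : p = piles (smaller p) (larger p).
Proof.
  pose proof (smaller_le_larger p); apply position_ext; simpl; lia.
Qed.

(** Since [piles a b = piles b a], naming the first pile covers either pile. *)
Inductive wythoff_move : position -> position -> Prop :=
| wythoff_one_pile (a b k : nat) :
    1 <= k -> k <= a -> wythoff_move (piles a b) (piles (a - k) b)
| wythoff_both_piles (a b k : nat) :
    1 <= k -> k <= a -> k <= b -> wythoff_move (piles a b) (piles (a - k) (b - k)).

(** In [e_wythoff_extra], [l < k <= a <= b], so neither subtraction truncates. *)
Inductive e_wythoff_move : position -> position -> Prop :=
| e_wythoff_old (p q : position) :
    wythoff_move p q -> e_wythoff_move p q
| e_wythoff_extra (a b k l : nat) :
    a <= b -> 1 <= k -> k <= a -> l < k ->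
    e_wythoff_move (piles a b) (piles (a - k) (b - l)).

(** The player about to move at [p] has a move to some [q] such that, whatever
    the opponent replies, they can again force a win; when the opponent has no
    reply, [p -> q] was the last move and wins outright. *)
Inductive can_force_win (move : position -> position -> Prop) : position -> Prop :=
| force_win (p q : position) :
    move p q ->
    (forall r : position, move q r -> can_force_win move r) ->
    can_force_win move p.

Definition P_position (move : position -> position -> Prop) (p : position) : Prop :=
  ~ can_force_win move p.

Definition phi : R := ((1 + sqrt 5) / 2)%R.

(** [Int_part] is the floor function; the argument is nonnegative, so
    [Z.to_nat] does not truncate. *)
Definition floor_phi (n : nat) : nat := Z.to_nat (Int_part (phi * INR n)).

(* Main.v *)
Require Import Defs.
From Stdlib Require Import Reals.
From Stdlib Require Import ZArith Arith Lia Lra.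

(** Write [A n = floor (phi n)] and [B n = A n + n = floor (phi^2 n)]. Since
    [1/phi + 1/phi^2 = 1], Beatty's theorem says that [A] and [B] partition the
    positive integers, which gives Wythoff's theorem. An extra move from
    [(A n, B n)] lowers the smaller pile and raises the difference of the piles;
    as [A] increases, no position [(A m, B m)] is reached, so the extra moves do
    not disturb the P-positions. *)

(** A terminating game has only one kernel, its set of lost positions: outside [W] a player moves
    into [W], and the opponent must leave it again. Both inductions go down two moves at a time,
    because [can_force_win] pairs a move with its reply. [absorb] supplies the case distinction on
    [W p]. *)
Lemma P_position_kernel (move : position -> position -> Prop)
    (weight : position -> nat) (W : position -> Prop) :
  (forall p q, move p q -> weight q < weight p) ->
  (forall p q, move p q -> W p -> ~ W q) ->
  (forall p, W p \/ exists q, move p q /\ W q) ->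
  forall p, P_position move p <-> W p.
Proof.
  intros decr stable absorb.
  assert (outside_wins : forall p, ~ W p -> can_force_win move p).
  { induction p as [p IH] using (well_founded_induction
      (well_founded_ltof position weight)); unfold ltof in IH.
    intros Np; destruct (absorb p) as [Wp | [q [pq Wq]]]; [contradiction |].
    apply force_win with q; [assumption |].
    intros r qr; apply IH.
    - pose proof (decr _ _ pq); pose proof (decr _ _ qr); lia.
    - now apply (stable q). }
  assert (inside_loses : forall p, W p -> ~ can_force_win move p).
  { induction p as [p IH] using (well_founded_induction
      (well_founded_ltof position weight)); unfold ltof in IH.
    intros Wp win; destruct win as [p q pq replies].
    destruct (absorb q) as [Wq | [r [qr Wr]]]; [now apply (stable p q) |].
    apply (IH r); auto.
    pose proof (decr _ _ pq); pose proof (decr _ _ qr); lia. }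
  intros p; split; [| apply inside_loses].
  intros Pp; destruct (absorb p) as [Wp | [q [pq Wq]]]; [assumption |].
  exfalso; apply Pp, outside_wins; intros Wp; now apply (stable p q).
Qed.

Lemma phi_sqr : (phi * phi = phi + 1)%R.
Proof.
  unfold phi; assert (H : (sqrt 5 * sqrt 5 = 5)%R) by (apply sqrt_sqrt; lra).
  nra.
Qed.

Lemma phi_gt_1 : (1 < phi)%R.
Proof.
  unfold phi; assert (H : (1 < sqrt 5)%R).
  { rewrite <- sqrt_1 at 1; apply sqrt_lt_1; lra. }
  lra.
Qed.

(* Descent along [(a, n) |-> (n, a - n)]. *)
Lemma golden_equation_nat (n a : nat) : a * a = a * n + n * n -> n = 0.
Proof.
  revert a; induction n as [n IH] using lt_wf_ind; intros a H.
  destruct (Nat.eq_dec n 0) as [| Hn]; [assumption |].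
  assert (n <= a) by nia.
  destruct (Nat.le_exists_sub n a) as [d [-> _]]; [assumption |].
  assert (d < n) by nia.
  (* Substituting [a = d + n] leaves [n * n = n * d + d * d], the same equation for the pair
     [(d, n)]. *)
  assert (d = 0) by (apply (IH d) with n; nia).
  subst; nia.
Qed.

Lemma phi_irrational (n a : nat) : (phi * INR n = INR a)%R -> n = 0.
Proof.
  intros H; apply (golden_equation_nat n a), INR_eq.
  rewrite plus_INR, !mult_INR, <- H; pose proof phi_sqr; nra.
Qed.

Lemma floor_phi_spec (n : nat) :
  (INR (floor_phi n) <= phi * INR n < INR (floor_phi n) + 1)%R.
Proof.
  unfold floor_phi.
  assert (Hpos : (0 <= phi * INR n)%R).
  { pose proof phi_gt_1; pose proof (pos_INR n); nra. }
  destruct (base_Int_part (phi * INR n)) as [H1 H2].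
  (* The integer part is thus nonnegative, so [Z.to_nat] preserves its value. *)
  assert (-1 < Int_part (phi * INR n))%Z by (apply lt_IZR; simpl; lra).
  rewrite INR_IZR_INZ, Z2Nat.id by lia; lra.
Qed.

Lemma floor_phi_unique (n a : nat) :
  (INR a <= phi * INR n < INR a + 1)%R -> floor_phi n = a.
Proof.
  intros H; pose proof (floor_phi_spec n).
  assert (floor_phi n < S a) by (apply INR_lt; rewrite S_INR; lra).
  assert (a < S (floor_phi n)) by (apply INR_lt; rewrite S_INR; lra).
  lia.
Qed.

Lemma floor_phi_incr (n m : nat) : n < m -> floor_phi n < floor_phi m.
Proof.
  intros H; apply INR_lt.
  pose proof (floor_phi_spec n); pose proof (floor_phi_spec m).
  assert (INR n + 1 <= INR m)%R by (rewrite <- S_INR; apply le_INR; lia).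
  pose proof phi_gt_1.
  assert (phi * (INR n + 1) <= phi * INR m)%R by (apply Rmult_le_compat_l; lra).
  lra.
Qed.

Lemma floor_phi_inj (n m : nat) : floor_phi n = floor_phi m -> n = m.
Proof.
  intros H; destruct (lt_eq_lt_dec n m) as [[L | E] | L]; [| assumption |];
    apply floor_phi_incr in L; lia.
Qed.

Lemma floor_phi_0 : floor_phi 0 = 0.
Proof. apply floor_phi_unique; simpl; lra. Qed.

(* If both equal [a > 0], then summing [a/phi < n < (a+1)/phi] and
   [a/phi^2 < m < (a+1)/phi^2] puts the integer [n + m] strictly between
   [a] and [a + 1]. *)
Lemma beatty_disjoint (n m : nat) :
  floor_phi n = floor_phi m + m -> n = 0 /\ m = 0.
Proof.
  intros H.
  destruct (Nat.eq_dec m 0) as [-> | Hm].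
  { split; [apply floor_phi_inj; rewrite H, floor_phi_0; lia | reflexivity]. }
  exfalso.
  pose proof (floor_phi_spec n) as Sn; pose proof (floor_phi_spec m) as Sm.
  (* Irrationality makes [floor_phi m < phi * m] strict, as the lower bound [L] requires. *)
  assert (E : (INR (floor_phi m) <> phi * INR m)%R).
  { intros E; symmetry in E; apply phi_irrational in E; lia. }
  rewrite H, plus_INR in Sn.
  pose proof phi_gt_1.
  set (x := INR n) in *; set (y := INR m) in *; set (c := INR (floor_phi m)) in *.
  (* Scaling by [phi * phi = phi + 1] replaces the divisions by [phi] and its square. *)
  assert (phi * (c + y) <= phi * (phi * x))%R by (apply Rmult_le_compat_l; lra).
  assert (phi * (phi * x) < phi * (c + y + 1))%R by (apply Rmult_lt_compat_l; lra).
  rewrite <- Rmult_assoc, phi_sqr in *.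
  assert (L : (c + y < x + y)%R) by (apply Rmult_lt_reg_l with (phi + 1)%R; lra).
  assert (U : (x + y < c + y + 1)%R) by (apply Rmult_lt_reg_l with (phi + 1)%R; lra).
  subst x y c; rewrite <- !plus_INR in L, U; rewrite <- S_INR in U.
  apply INR_lt in L, U; lia.
Qed.

(* With [n] the last index such that [floor (phi n) <= a], either [a] is that
   value or [a = floor (phi^2 (a - n))]. *)
Lemma beatty_cover (a : nat) :
  (exists n, a = floor_phi n) \/ (exists m, a = floor_phi m + m).
Proof.
  assert (last : exists n, floor_phi n <= a < floor_phi (S n)).
  { induction a as [| a [n IH]].
    - exists 0; pose proof (floor_phi_incr 0 1); rewrite floor_phi_0 in *; lia.
    - destruct (le_lt_dec (floor_phi (S n)) (S a)).
      + exists (S n); pose proof (floor_phi_incr (S n) (S (S n))); lia.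
      + exists n; lia. }
  destruct last as [n [L U]].
  destruct (Nat.eq_dec (floor_phi n) a) as [E | E]; [left; now exists n |].
  right.
  pose proof (floor_phi_spec n) as Sn; pose proof (floor_phi_spec (S n)) as Sn'.
  (* Irrationality gives [a + 1 < phi * (n + 1)] strictly; multiplied by [phi], this becomes
     [phi * (a - n) < n + 1]. *)
  assert (I : (INR (S a) <> phi * INR (S n))%R).
  { intros I; symmetry in I; apply phi_irrational in I; discriminate. }
  assert (L' : (phi * INR n < INR a)%R).
  { assert (INR (S (floor_phi n)) <= INR a)%R as B by (apply le_INR; lia).
    rewrite S_INR in B; lra. }
  assert (U' : (INR (S a) <= INR (floor_phi (S n)))%R) by (apply le_INR; lia).
  pose proof phi_gt_1.
  assert (n <= a).
  { apply INR_le; pose proof (pos_INR n).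
    assert (1 * INR n <= phi * INR n)%R by (apply Rmult_le_compat_r; lra); lra. }
  exists (a - n).
  enough (floor_phi (a - n) = n) by lia.
  apply floor_phi_unique; rewrite minus_INR by assumption.
  rewrite !S_INR in *.
  assert (phi * (phi * INR n) < phi * INR a)%R by (apply Rmult_lt_compat_l; lra).
  assert (phi * (INR a + 1) < phi * (phi * (INR n + 1)))%R by (apply Rmult_lt_compat_l; lra).
  rewrite <- Rmult_assoc, phi_sqr in *; lra.
Qed.

Definition wythoff_pair (p : position) : Prop :=
  exists n : nat, p = piles (floor_phi n) (floor_phi n + n).

Lemma wythoff_pair_piles (a b : nat) :
  wythoff_pair (piles a b) ->
  exists n, (a = floor_phi n /\ b = floor_phi n + n) \/
            (a = floor_phi n + n /\ b = floor_phi n).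
Proof. intros [n H]; exists n; now apply piles_eq_iff. Qed.

(** A one-pile move keeps a pile, which as a term of [A] or [B] determines the pair, by monotonicity
    and disjointness. A two-pile move keeps the difference, which is the index [n]. *)
Lemma wythoff_move_stable (p q : position) :
  wythoff_move p q -> wythoff_pair p -> ~ wythoff_pair q.
Proof.
  intros [a b k Hk Ha | a b k Hk Ha Hb] Wp Wq;
    apply wythoff_pair_piles in Wp as [n Hn];
    apply wythoff_pair_piles in Wq as [m Hm].
  - destruct Hn as [[En En'] | [En En']], Hm as [[Em Em'] | [Em Em']].
    + assert (n = m \/ n < m \/ m < n) as [| [L | L]] by lia;
        [subst; lia | pose proof (floor_phi_incr _ _ L); lia ..].
    + assert (floor_phi m = floor_phi n + n) as E by lia.
      apply beatty_disjoint in E; lia.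
    + assert (floor_phi n = floor_phi m + m) as E by lia.
      apply beatty_disjoint in E; lia.
    + assert (n = m) by (apply floor_phi_inj; lia); subst; lia.
  - assert (n = m) by lia; subst; lia.
Qed.

Lemma e_wythoff_move_stable (p q : position) :
  e_wythoff_move p q -> wythoff_pair p -> ~ wythoff_pair q.
Proof.
  intros [p' q' M | a b k l Hab Hk Ha Hl] Wp Wq;
    [now apply (wythoff_move_stable p' q') |].
  apply wythoff_pair_piles in Wp as [n Hn].
  apply wythoff_pair_piles in Wq as [m Hm].
  (* The differences of the piles give [m = n + (k - l)]. *)
  assert (n < m) as L by lia; apply floor_phi_incr in L; lia.
Qed.

Lemma wythoff_move_absorb (p : position) :
  wythoff_pair p \/ exists q, wythoff_move p q /\ wythoff_pair q.
Proof.
  rewrite (piles_surj p); pose proof (smaller_le_larger p) as Hab.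
  generalize dependent (larger p); generalize (smaller p); intros a b Hab.
  assert (lower_b : forall c, c < b -> wythoff_pair (piles a c) ->
    exists q, wythoff_move (piles a b) q /\ wythoff_pair q).
  { intros c Hc Wc; exists (piles a c); split; [| assumption].
    (* [wythoff_one_pile] lowers the first pile named, so the piles are swapped. *)
    replace (piles a b) with (piles b a) by (apply piles_eq_iff; lia).
    replace (piles a c) with (piles (b - (b - c)) a) by (apply piles_eq_iff; lia).
    constructor; lia. }
  destruct (beatty_cover a) as [[n Hn] | [n Hn]].
  - destruct (lt_eq_lt_dec b (floor_phi n + n)) as [[L | E] | L].
    (* The difference [d] is less than [n], so removing equally from both piles reaches the pair of
       index [d]. *)
    + right; set (d := b - a).
      assert (floor_phi d < floor_phi n) by (apply floor_phi_incr; lia).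
      exists (piles (a - (a - floor_phi d)) (b - (a - floor_phi d))); split.
      * constructor; lia.
      * exists d; apply piles_eq_iff; lia.
    + left; exists n; now rewrite Hn, E.
    + right; apply (lower_b (floor_phi n + n)); [assumption |].
      exists n; now rewrite Hn.
  - destruct (lt_dec (floor_phi n) b) as [L | L].
    + right; apply (lower_b (floor_phi n)); [assumption |].
      exists n; apply piles_eq_iff; lia.
    (* Here [floor_phi n + n = a <= b <= floor_phi n] forces [n = 0]: both piles are empty. *)
    + left; exists n; apply piles_eq_iff; lia.
Qed.

Definition tokens (p : position) : nat := smaller p + larger p.

Lemma wythoff_move_tokens (p q : position) :
  wythoff_move p q -> tokens q < tokens p.
Proof. unfold tokens; intros []; simpl; lia. Qed.

Lemma e_wythoff_move_tokens (p q : position) :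
  e_wythoff_move p q -> tokens q < tokens p.
Proof.
  intros [p' q' M |]; [now apply wythoff_move_tokens |].
  unfold tokens; simpl; lia.
Qed.

Lemma e_wythoff_move_absorb (p : position) :
  wythoff_pair p \/ exists q, e_wythoff_move p q /\ wythoff_pair q.
Proof.
  destruct (wythoff_move_absorb p) as [Wp | [q [M Wq]]]; [now left | right].
  exists q; split; [now constructor | assumption].
Qed.

Theorem theorem3p1 :
  (forall p : position,
      P_position e_wythoff_move p <-> P_position wythoff_move p) /\
  (forall p : position,
      P_position wythoff_move p <->
      exists n : nat, p = piles (floor_phi n) (floor_phi n + n)).
Proof.
  pose proof (P_position_kernel _ _ _ wythoff_move_tokens
    wythoff_move_stable wythoff_move_absorb) as K.
  pose proof (P_position_kernel _ _ _ e_wythoff_move_tokens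
    e_wythoff_move_stable e_wythoff_move_absorb) as Ke.
  split; [intros p; now rewrite K, Ke | exact K].
Qed.
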